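(* Let $G$ be a Garside group. The periodicity of an element of $G$ does not depend on the choice of a particular Garside element (that is, for any two Garside elements $\Delta_1,\Delta_2$ of $G$ and any $g\in G$, $g$ is periodic with respect to $\Delta_1$ if and only if $g$ is periodic with respect to $\Delta_2$) if and only if the center $Z(G)$ is cyclic.
   Context: Garside groups. In a monoid $M$, an atom is an element $a\neq 1$ such that $a=bc$ implies $b=1$ or $c=1$; $\Vert a\Vert$ is the supremum of the lengths of expressions of $a$ as products of atoms. $M$ is atomic if it is generated by its atoms and $\Vert a\Vert<\infty$ for all $a\in M$. Put $a\le_L b$ if $ac=b$ for some $c\in M$, and $a\le_R b$ if $ca=b$ for some $c\in M$. A Garside monoid is an atomic, left and right cancellative monoid $M$ such that $(M,\le_L)$ and $(M,\le_R)$ are lattices and $M$ contains a Garside element $\Delta$, i.e. an element such that for each $a\in M$, $a\le_L\Delta$ iff $a\le_R\Delta$, and the set $[1,\Delta]=\{a\in M: 1\le_L a\le_L\Delta\}$ is finite and generates $M$. A Garside group $G$ is the group of fractions of a Garside monoid $M$; $M$ is identified with its image in $G$ and denoted $G^+$, and $(G^+,\Delta)$ is called a Garside structure on $G$. A group may have several Garside structures. A Garside element of $G$ is an element $\Delta$ occurring in some Garside structure $(G^+,\Delta)$ on $G$. An element $g\in G$ is periodic with respect to a Garside element $\Delta$ if $g^k=\Delta^\ell$ for some integers $k\ne 0$ and $\ell$. *)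

(* Defs.v *)
From HB Require Import structures.
From mathcomp Require Import all_boot ssrint.
From mathcomp Require Import boolp classical_sets cardinality.

Set Implicit Arguments.
Unset Strict Implicit.
Unset Printing Implicit Defensive.

Local Open Scope classical_set_scope.
Local Open Scope group_scope.

Section MonoidDefs.
Variable M : monoidType.
Implicit Types (a b c : M) (A : set M) (s : seq M).

Definition generates A : Prop :=
  forall a, exists s, (forall x, x \in s -> A x) /\ a = \prod_(x <- s) x.

Definition atom a : Prop :=
  a <> 1 /\ forall b c, a = b * c -> b = 1 \/ c = 1.

Definition atom_lengths a : set nat :=
  [set n | exists s, [/\ forall x, x \in s -> atom x,
                         a = \prod_(x <- s) x & size s = n]].

(* The norm of a is the supremum of atom_lengths a in nat + {infinity}, so it
   is finite exactly when this set of natural numbers is bounded. *)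
Definition finite_norm a : Prop :=
  exists N : nat, forall n, atom_lengths a n -> n <= N.

Definition atomic : Prop := generates atom /\ forall a, finite_norm a.

Definition leL a b : Prop := exists c, a * c = b.
Definition leR a b : Prop := exists c, c * a = b.

Definition left_cancellative : Prop :=
  forall a b c, a * b = a * c -> b = c.
Definition right_cancellative : Prop :=
  forall a b c, b * a = c * a -> b = c.

Definition is_partial_order (le : M -> M -> Prop) : Prop :=
  [/\ forall a, le a a,
      forall a b, le a b -> le b a -> a = b
    & forall a b c, le a b -> le b c -> le a c].

Definition is_join (le : M -> M -> Prop) a b c : Prop :=
  [/\ le a c, le b c & forall d, le a d -> le b d -> le c d].
Definition is_meet (le : M -> M -> Prop) a b c : Prop :=
  [/\ le c a, le c b & forall d, le d a -> le d b -> le d c].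

Definition is_lattice (le : M -> M -> Prop) : Prop :=
  [/\ is_partial_order le,
      forall a b, exists c, is_join le a b c
    & forall a b, exists c, is_meet le a b c].

Definition interval1 D : set M := [set a | leL 1 a /\ leL a D].

Definition garside_element_of_monoid D : Prop :=
  [/\ forall a, leL a D <-> leR a D,
      finite_set (interval1 D)
    & generates (interval1 D)].

Record garside_monoid : Prop := GarsideMonoid {
  garside_atomic : atomic;
  garside_left_cancellative : left_cancellative;
  garside_right_cancellative : right_cancellative;
  garside_lattice_leL : is_lattice leL;
  garside_lattice_leR : is_lattice leR;
  garside_has_element : exists D, garside_element_of_monoid D }.

End MonoidDefs.

Section GroupDefs.
Variable G : groupType.
Implicit Types (g x z D : G).

(* G, together with the embedding i, is the group of fractions of M.  Only
   right fractions are required: in a Garside monoid any two elements have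
   common multiples on both sides (Ore conditions), so every right fraction is
   also a left one, and this determines (G, i) up to unique isomorphism. *)
Definition group_of_fractions (M : monoidType) (i : M -> G) : Prop :=
  [/\ i 1 = 1,
      forall a b, i (a * b) = i a * i b,
      injective i
    & forall g, exists a b, g = i a / i b].

(* The pair (G^+, Delta), where G^+ is the image of i and Delta is i D. *)
Definition garside_structure (M : monoidType) (i : M -> G) (D : M) : Prop :=
  [/\ garside_monoid M, group_of_fractions i & garside_element_of_monoid D].

Definition garside_group : Prop :=
  exists (M : monoidType) (i : M -> G) (D : M), garside_structure i D.

Definition garside_element D : Prop :=
  exists (M : monoidType) (i : M -> G) (D0 : M),
    garside_structure i D0 /\ i D0 = D.

Definition expgz x (n : int) : G :=
  match n with Posz m => x ^+ m | Negz m => x ^- m.+1 end.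

Definition periodic D g : Prop :=
  exists k l : int, k <> Posz 0 /\ expgz g k = expgz D l.

Definition center : set G := [set z | forall g, z * g = g * z].

Definition cyclic_subset (A : set G) : Prop :=
  exists z, A = [set x | exists n : int, x = expgz z n].

End GroupDefs.

Arguments garside_group : clear implicits.
Arguments center : clear implicits.

(* Main.v *)
(* A Garside element Delta permutes [1, Delta] by conjugation, so some power of
   it is central; when Z(G) is cyclic, the central powers of two Garside elements
   are therefore commensurable.

   Conversely, every central g is a quotient x / Delta^n with Delta^n central and
   x a central multiple of Delta.  Such an x is again a Garside element, so
   independence of periodicity makes a power of x a power of Delta.  In a
   Garside monoid z^k | x^k implies z | x for central x and z, hence g or its
   inverse is positive.  The positive central elements are thus totally ordered
   by divisibility, and lengths in atoms make them the powers of the smallest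
   non-trivial one. *)
Require Import Defs.
From mathcomp Require Import all_boot.
From mathcomp Require Import fingroup perm ssralg ssrint zify.
From mathcomp Require Import boolp classical_sets cardinality.

Set Implicit Arguments.
Unset Strict Implicit.
Unset Printing Implicit Defensive.

Local Open Scope group_scope.

(** * Divisibility and atom lengths in a monoid *)

Section DivisibilityMonoid.
Variable M : monoidType.
Implicit Types (a b c d z D : M) (A : set M) (s : seq M).

Lemma leL_trans a b c : leL a b -> leL b c -> leL a c.
Proof. by move=> [u <-] [v <-]; exists (u * v); rewrite mulgA. Qed.

Lemma leL1 a : leL 1 a.
Proof. by exists a; rewrite mul1g. Qed.

Lemma leL_mulr a b : leL a (a * b).
Proof. by exists b. Qed.

Lemma leL_mul2l c a b : leL a b -> leL (c * a) (c * b).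
Proof. by move=> [u <-]; exists u; rewrite mulgA. Qed.

Lemma big_mulg_cat s s' :
  \prod_(x <- s ++ s') x = \prod_(x <- s) x * \prod_(x <- s') x.
Proof. exact: big_cat. Qed.

(** An atom splits only trivially, so peeling factors off the product must meet it. Hence every
    generating set contains all atoms. *)
Lemma atom_mem_factors {a s} : atom a -> a = \prod_(x <- s) x -> a \in s.
Proof.
move=> [a1 ha]; elim: s => [|x s IH]; rewrite ?big_nil ?big_cons // => e.
have [x1|s1] := ha _ _ e; rewrite inE.
- by rewrite IH ?orbT // e x1 mul1g.
- by rewrite e s1 mulg1 eqxx.
Qed.

Lemma atom_lengths_mul a b m n :
  atom_lengths a m -> atom_lengths b n -> atom_lengths (a * b) (m + n).
Proof.
move=> [s [hs -> <-]] [t [ht -> <-]]; exists (s ++ t); split.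
- by move=> x; rewrite mem_cat => /orP[/hs|/ht].
- by rewrite big_mulg_cat.
- by rewrite size_cat.
Qed.

Lemma atom_lengths_ex a : atomic M -> exists n, atom_lengths a n.
Proof.
by move=> [/(_ a)[s [hs e]] _]; exists (size s); exists s.
Qed.

Lemma atom_lengths_neq1 a n : a <> 1 -> atom_lengths a n -> 0 < n.
Proof. by move=> a1 [[|x s] [_ e <-]] //; rewrite big_nil in e. Qed.

(** As [z] is a product of at least one atom, each atomic expression of [c] extends to a strictly
    longer one of [z * c]. This drives the descent on length bounds. *)
Lemma atom_lengths_bound_cofactor z c N : atomic M -> z <> 1 ->
  (forall n, atom_lengths (z * c) n -> n <= N) ->
  0 < N /\ forall n, atom_lengths c n -> n <= N.-1.
Proof.
move=> aM z1 hN.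
have [p hp] := atom_lengths_ex z aM; have p0 := atom_lengths_neq1 z1 hp.
split=> [|n hn].
- have [n hn] := atom_lengths_ex c aM.
  by have := hN _ (atom_lengths_mul hp hn); lia.
- by have := hN _ (atom_lengths_mul hp hn); lia.
Qed.

Lemma finite_products A n : finite_set A ->
  finite_set [set a | exists s, [/\ forall x, x \in s -> A x,
                                   a = \prod_(x <- s) x & size s <= n]].
Proof.
move=> fA; elim: n => [|n IH].
  apply: (sub_finite_set _ (finite_set1 1)) => a [s [_ -> ]].
  by rewrite leqn0 size_eq0 => /eqP->; rewrite big_nil.
have fAS := finite_image2 *%g fA IH.
have := conj (finite_set1 (1 : M)) fAS; rewrite -finite_setU.
apply: sub_finite_set => a.
move=> [[|x s] [hs -> hn]]; first by left; rewrite big_nil.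
right; exists x; first by apply: hs; rewrite inE eqxx.
exists (\prod_(y <- s) y); last by rewrite big_cons.
by exists s; split=> // y ys; apply: hs; rewrite inE ys orbT.
Qed.

Lemma generates_sub A B : (A `<=` B)%classic -> generates A -> generates B.
Proof. by move=> AB gA a; have [s [hs e]] := gA a; exists s; split=> // x /hs/AB. Qed.

Lemma commute_generates A z :
  generates A -> (forall a, A a -> commute z a) -> forall a, commute z a.
Proof.
move=> gA hz a; have [s [hs ->]] := gA a; elim: s hs {a} => [|x s IH] hs.
  by rewrite big_nil; apply: commute1.
rewrite big_cons; apply: commuteM; first by apply/hz/hs; rewrite inE eqxx.
by apply: IH => y ys; apply: hs; rewrite inE ys orbT.
Qed.

End DivisibilityMonoid.

(** * Central elements and divisors in a Garside monoid *)

Section GarsideMonoid.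
Variables (M : monoidType) (gM : garside_monoid M).
Implicit Types (a b c d z D : M).

Let lcM := garside_left_cancellative gM.
Let rcM := garside_right_cancellative gM.
Let aM := garside_atomic gM.

Lemma leL_antisym a b : leL a b -> leL b a -> a = b.
Proof. by case: (garside_lattice_leL gM) => -[_ h _] _ _; apply: h. Qed.

Lemma garside_mul_eq1 a b : a * b = 1 -> a = 1.
Proof. by move=> e; apply: leL_antisym; [exists b | apply: leL1]. Qed.

Lemma garside_exp_eq1 a n : 0 < n -> a ^+ n = 1 -> a = 1.
Proof. by case: n => // n _; rewrite expgS => /garside_mul_eq1. Qed.

Lemma leL_cancel a b c : leL (a * b) (a * c) -> leL b c.
Proof. by move=> [u]; rewrite -mulgA => /lcM <-; exists u. Qed.

Lemma join_family (e : nat -> M) n : exists J,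
  (forall i, i < n -> leL (e i) J) /\
  (forall X, (forall i, i < n -> leL (e i) X) -> leL J X).
Proof.
elim: n => [|n [J [ub lub]]]; first by exists 1; split=> // X _; apply: leL1.
case: (garside_lattice_leL gM) => _ /(_ J (e n)) [K [JK eK hK]] _.
exists K; split=> [i|X hX].
- rewrite ltnS leq_eqVlt => /orP[/eqP-> //|/ub h]; exact: leL_trans h JK.
- by apply: hK; [apply: lub => i li; apply: hX; lia | apply: hX].
Qed.

(* With J the join of the a^i z^(k-i) for i < k, multiplying by a shifts the
   family, so z J is below a J. *)
Lemma leL_exp_inv a z k : (forall x, commute a x) -> (forall x, commute z x) ->
  0 < k -> leL (z ^+ k) (a ^+ k) -> leL z a.
Proof.
move=> ca cz k0 hk; pose e i := a ^+ i * z ^+ (k - i).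
have [J [ub lub]] := join_family e k.
have shift i : i < k -> a * e i = z * e i.+1.
  move=> ik; rewrite /e mulgA -expgS [RHS]mulgA (commuteX i.+1 (cz a)).
  by rewrite -mulgA -expgS; congr (_ * _ ^+ _); lia.
have aJ i : i < k -> leL (z * e i.+1) (a * J).
  by move=> ik; rewrite -shift //; apply/leL_mul2l/ub.
have zJ i : i < k -> leL (z * e i) (a * J).
  case: i => [_|i ik]; last by apply: aJ; lia.
  (* The shift does not reach index 0; there the hypothesis puts [z * z ^+ k] below [z * a ^+ k],
     the last term of the shifted family. *)
  have := aJ k.-1; rewrite prednK // => /(_ (leqnn _)); apply: leL_trans.
  by apply: leL_mul2l; rewrite /e subn0 subnn expg0 mul1g mulg1.
have [Y hY] : leL z (a * J) by apply: leL_trans (zJ 0 k0); apply: leL_mulr.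
have JY : leL J Y by apply: lub => i ik; apply: (@leL_cancel z); rewrite hY; apply: zJ.
have [u hu] : leL (z * J) (a * J) by rewrite -hY; apply: leL_mul2l.
exists u; apply: (@lcM J); rewrite -(ca J) -hu (cz J); by rewrite mulgA.
Qed.

Lemma central_garside_power D : garside_element_of_monoid D ->
  exists2 m, 0 < m & forall a, commute (D ^+ m) a.
Proof.
move=> [LR /finite_seqP[s es] gD].
have inD a : (a \in s) <-> leL a D.
  have <- : interval1 D a = (a \in s) :> Prop by rewrite es.
  split=> [[]//|h].
  by split=> //; apply: leL1.
(* Taking complements twice is conjugation by [D]: from [t * b = D] and [b * c = D] follows
   [t * D = t * b * c * (1)]-free form [D * c] after multiplying [b * c = D] by [t]. *)
have /choice[f hf] (t : seq_sub s) : exists u : seq_sub s, val t * D = D * val u.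
  have [b hb] := (inD _).1 (valP t).
  have [c hc] : leL b D by apply/LR; exists (val t).
  have cs : c \in s by apply/inD/LR; exists b.
  by exists (SeqSub cs); rewrite /= -{1}hc mulgA hb.
have injf : injective f.
  by move=> a b e; apply/val_inj/(@rcM D); rewrite !hf e.
pose p := perm injf; exists #[p]; first exact: order_gt0.
apply: (commute_generates gD) => a ha.
have as_ : a \in s by apply/inD; case: ha.
have key n : a * D ^+ n = D ^+ n * val ((p ^+ n)%g (SeqSub as_)).
  elim: n => [|n IH]; first by rewrite perm1 mulg1 mul1g.
  rewrite expgSr mulgA IH -mulgA hf expgSr permM permE mulgA //.
by rewrite /commute key expg_order perm1.
Qed.

Lemma leL_central_power D m : garside_element_of_monoid D -> 0 < m ->
  (forall a, commute (D ^+ m) a) -> forall a, exists n, leL a ((D ^+ m) ^+ n).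
Proof.
move=> [_ _ gD] m0 cz a; have [s [hs ->]] := gD a.
elim: s hs {a} => [|x s IH] hs; first by exists 0; rewrite big_nil; apply: leL1.
have [n [u hu]] : exists n, leL (\prod_(y <- s) y) ((D ^+ m) ^+ n).
  by apply: IH => y ys; apply: hs; rewrite inE ys orbT.
have [_ [v hv]] := hs x (mem_head _ _).
(* Centrality moves [(D ^+ m) ^+ n] to the left of [x]; then [x * v = D] and the remaining
   [D ^+ m.-1] complete one more factor [D ^+ m]. *)
exists n.+1; rewrite big_cons; exists (u * v * D ^+ m.-1).
rewrite !mulgA -(mulgA x) hu (commuteX n (commute_sym (cz x))).
by rewrite -!mulgA (mulgA x v) hv -expgS prednK // -expgSr.
Qed.

(** All atoms lie in the finite generating set of divisors of [D], and a divisor of [a] is a product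
    of boundedly many of them. *)
Lemma finite_divisors D a : garside_element_of_monoid D ->
  finite_set (interval1 a).
Proof.
move=> [_ fD gD]; have [gA /(_ a)[N hN]] := aM.
have fA : finite_set (@atom M).
  apply: sub_finite_set fD => x ax; have [s [hs e]] := gD x.
  exact/hs/(atom_mem_factors ax e).
apply: (sub_finite_set _ (finite_products N fA)) => b [_ [c e]].
have [s [hs eb]] := gA b; exists s; split=> //.
have [n hn] := atom_lengths_ex c aM.
have : atom_lengths a (size s + n).
  by rewrite -e; apply: atom_lengths_mul => //; exists s.
by move/hN; lia.
Qed.

(** Centrality turns a left cofactor in [x] into a right one by cancellation, and the divisors of
    [x] include those of [D], which generate. *)
Lemma central_multiple_garside D x : garside_element_of_monoid D ->
  (forall a, commute x a) -> leL D x -> garside_element_of_monoid x.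
Proof.
move=> hD cx Dx; split=> [a||].
- split=> [[c hc]|[c hc]]; exists c.
    by apply: (@lcM a); rewrite mulgA hc cx.
  by apply: (@rcM a); rewrite -mulgA hc cx.
- exact: finite_divisors hD.
- case: hD => _ _; apply: generates_sub => a [h1 aD]; split=> //.
  exact: leL_trans aD Dx.
Qed.

Lemma trivial_of_garside1 : garside_element_of_monoid (1 : M) -> forall a : M, a = 1.
Proof.
move=> [_ _ g1] a; have [s [hs ->]] := g1 a; rewrite big_seq big1 // => x /hs[_ x1].
exact: leL_antisym x1 (leL1 _).
Qed.

(** The generator is a non-trivial element of [P] with the least bound on atom lengths: a proper
    non-trivial divisor in [P] would leave a cofactor with a smaller bound. The case [z = 1] covers
    a [P] without non-trivial elements. *)
Lemma cyclic_of_total (P : M -> Prop) :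
  (forall a b, P (a * b) -> P a -> P b) ->
  (forall a b, P a -> P b -> leL a b \/ leL b a) ->
  exists2 z, P z \/ z = 1 & forall a, P a -> exists n, a = z ^+ n.
Proof.
move=> hP tot; pose bd a N := forall n, atom_lengths a n -> n <= N.
have [[z0 [P0 z0n]]|none] := pselect (exists z, P z /\ z <> 1); last first.
  exists 1; [by right | move=> a Pa; exists 0; rewrite expg0].
  by apply: contrapT => a1; apply: none; exists a.
have [z [N [Pz zn bz minz]]] : exists z N, [/\ P z, z <> 1, bd z N
    & forall c n, P c -> c <> 1 -> bd c n -> N <= n].
  have ex : exists n, `[< exists z, [/\ P z, z <> 1 & bd z n] >].
    by have [_ /(_ z0)[n hn]] := aM; exists n; apply/asboolP; exists z0.
  case: (ex_minnP ex) => N /asboolP[z [Pz zn bz]] mn.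
  exists z, N; split=> // c n Pc cn bc; apply: mn; apply/asboolP; by exists c.
exists z; first by left.
suff h n a : P a -> bd a n -> exists k, a = z ^+ k.
  by move=> a Pa; have [_ /(_ a)[n /h]] := aM; apply.
elim: n a => [|n IH] a Pa ba.
  exists 0; rewrite expg0; apply: contrapT => a1.
  have [n hn] := atom_lengths_ex a aM.
  have := ba _ hn; have := atom_lengths_neq1 a1 hn; lia.
have [[c ec]|[c ec]] := tot z a Pz Pa.
- rewrite -ec in Pa ba; have [_ bc] := atom_lengths_bound_cofactor aM zn ba.
  have [k ek] := IH c (hP _ _ Pa Pz) bc.
  by exists k.+1; rewrite -ec ek expgS.
- have [a1|a1] := pselect (a = 1); first by exists 0.
  rewrite -ec in Pz bz; have [N0 bc] := atom_lengths_bound_cofactor aM a1 bz.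
  have [c1|c1] := pselect (c = 1); first by exists 1%N; rewrite -ec c1 mulg1 expg1.
  have := minz c _ (hP _ _ Pz Pa) c1 bc; lia.
Qed.

End GarsideMonoid.

(** * Integer powers and the center of a group *)

Section IntegerPowers.
Variable G : groupType.
Implicit Types (x y g D : G) (m n : int).

Lemma commute_expgz x y n : commute x y -> commute x (expgz y n).
Proof. by move=> c; case: n => n /=; [|apply: commuteV]; apply: commuteX. Qed.

Lemma expgzN x n : expgz x (- n)%R = (expgz x n)^-1.
Proof. by case: n => [[|n]|n] //=; rewrite ?expg0 ?invg1 ?invgK. Qed.

Lemma expgzM x m n : expgz x (m * n)%R = expgz (expgz x m) n.
Proof.
have pos y (a : nat) k : expgz y (a%:Z * k)%R = expgz (y ^+ a) k.
  case: k => k; first by rewrite -PoszM /= expgnA.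
  by rewrite NegzE GRing.mulrN -PoszM !expgzN /= expgnA.
case: m => m; first by rewrite pos.
rewrite NegzE GRing.mulNr !expgzN pos /=.
by case: n => n /=; rewrite expVgn.
Qed.

End IntegerPowers.

Section Center.
Variable G : groupType.
Implicit Types (x y : G).

Lemma center_mul x y : center G x -> center G y -> center G (x * y).
Proof. by move=> cx cy g; apply/commute_sym/commuteM; apply/commute_sym. Qed.

Lemma center_inv x : center G x -> center G x^-1.
Proof. by move=> cx g; apply/commute_sym/commuteV/commute_sym. Qed.

Lemma center_expgz x n : center G x -> center G (expgz x n).
Proof. by move=> cx g; apply/commute_sym/commute_expgz/commute_sym. Qed.

End Center.

(** * From the Garside monoid to its group of fractions *)

Section GarsideGroup.
Variables (G : groupType) (M : monoidType) (i : M -> G) (D : M).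
Hypothesis gs : garside_structure i D.
Implicit Types (a b c p x z : M) (g : G).

Let gM : garside_monoid M. Proof. by case: gs. Qed.
Let gD : garside_element_of_monoid D. Proof. by case: gs. Qed.
Let i1 : i 1 = 1. Proof. by case: gs => _ []. Qed.
Let iM a b : i (a * b) = i a * i b. Proof. by case: gs => _ []. Qed.
Let iI : injective i. Proof. by case: gs => _ []. Qed.
Let iF g : exists a b, g = i a / i b. Proof. by case: gs => _ []. Qed.

Lemma fraction_exp a n : i (a ^+ n) = i a ^+ n.
Proof. by elim: n => // n IH; rewrite !expgS iM IH. Qed.

Lemma fraction_center x : center G (i x) <-> forall a, commute x a.
Proof.
split=> cx a; first by apply: iI; rewrite !iM.
have [b [c ->]] := iF a.
have ci d : commute (i x) (i d) by rewrite /commute -!iM cx.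
by apply: commuteM => //; apply: commuteV.
Qed.

Lemma garside_power_center : exists2 m, 0 < m & center G (i D ^+ m).
Proof.
have [m m0 cm] := central_garside_power gM gD.
by exists m => //; rewrite -fraction_exp; apply/fraction_center.
Qed.

Lemma center_decomposition m g : 0 < m -> (forall a, commute (D ^+ m) a) ->
  center G g -> exists x n, [/\ g = i x / i ((D ^+ m) ^+ n),
    forall a, commute x a & leL D x].
Proof.
move=> m0 cz cg; set z := D ^+ m.
have [a [b eg]] := iF g.
have [n [b' hb]] := leL_central_power gD m0 cz b.
have e : g * i (z ^+ n.+1) = i (a * b' * z).
  by rewrite expgSr -hb eg !iM !mulgA mulgVK.
(* The extra factor [z] beyond [z ^+ n] makes the numerator a multiple of [D]. *)
exists (a * b' * z), n.+1; split; first by rewrite -e mulgK.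
- apply/fraction_center; rewrite -e; apply: center_mul => //.
  by apply/fraction_center => y; apply/commute_sym/commuteX/commute_sym/cz.
- by rewrite -cz -(prednK m0) expgS -mulgA; apply: leL_mulr.
Qed.

Lemma center_total g :
  (forall D' : G, garside_element D' -> forall h, periodic D' h -> periodic (i D) h) ->
  center G g -> (exists a, g = i a) \/ (exists a, g^-1 = i a).
Proof.
move=> hper cg.
have [m m0 cz] := central_garside_power gM gD.
have [x [n [eg cx Dx]]] := center_decomposition m0 cz cg.
set z := D ^+ m in cz eg; set w := z ^+ n in eg.
have cw a : commute w a by apply/commute_sym/commuteX/commute_sym/cz.
(* [i x] is a Garside element and is periodic with respect to itself. *)
have [k [l [k0 ekl]]] : periodic (i D) (i x).
  apply: (hper (i x)); last by exists (Posz 1), (Posz 1).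
  exists M, i, x; split=> //; case: gs => ? ? _; split=> //.
  exact: (central_multiple_garside gM gD).
have [K [L [K0 eKL]]] : exists (K : nat) (L : int),
    0 < K /\ i x ^+ K = expgz (i D) L.
  case: k k0 ekl => [[|k]|k] // _ ekl; first by exists k.+1, l.
  by exists k.+1, (- l)%R; rewrite expgzN -ekl invgK.
(* Raising to the power [m] replaces the power of [D] by one of the central [z], comparable with
   powers of [w]. *)
have eq : i (x ^+ (K * m)) = expgz (i z) L.
  rewrite !fraction_exp expgnA eKL.
  by rewrite -[LHS]/(expgz _ (Posz m)) -expgzM GRing.mulrC expgzM.
have Km0 : 0 < K * m by rewrite muln_gt0 K0.
have ezw q : (q <= n * (K * m)) \/ (n * (K * m) <= q) by apply/orP/leq_total.
have zle (r q : nat) : r <= q -> leL (z ^+ r) (z ^+ q).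
  by move=> /subnKC <-; rewrite expgnDr; apply: leL_mulr.
have [h|h] : leL (x ^+ (K * m)) (w ^+ (K * m)) \/ leL (w ^+ (K * m)) (x ^+ (K * m)).
  rewrite /w -expgnA; case: L eq {eKL} => p /= eq.
    have -> : x ^+ (K * m) = z ^+ p by apply: iI; rewrite eq fraction_exp.
    by have [/zle|/zle] := ezw p; [left|right].
  (* For a negative exponent the inverse of [x ^+ (K * m)] is positive, so this element divides
     1. *)
  left; apply: leL_trans (leL1 _); exists (z ^+ p.+1); apply: iI.
  by rewrite iM eq fraction_exp mulVg i1.
- have [u hu] := leL_exp_inv gM cw cx Km0 h.
  right; exists u; rewrite eg -hu invgF (cx u) iM mulgK //.
- have [u hu] := leL_exp_inv gM cx cw Km0 h.
  by left; exists u; rewrite eg -hu cw iM mulgK.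
Qed.

Lemma cyclic_center_of_periodic :
  (forall D' : G, garside_element D' -> forall h, periodic D' h -> periodic (i D) h) ->
  cyclic_subset (center G).
Proof.
move=> hper; have tot := fun g => @center_total g hper.
have [z hz zgen] : exists2 z, center G (i z) \/ z = 1 &
    forall a, center G (i a) -> exists n, a = z ^+ n.
  apply: (@cyclic_of_total _ gM (fun a => center G (i a))) => [a b cab ca|a b ca cb].
    have -> : i b = (i a)^-1 * i (a * b) by rewrite iM mulKg.
    by apply: center_mul => //; apply: center_inv.
  have := ca; have := cb => /fraction_center cb' /fraction_center ca'.
  (* Positivity of [i a / i b] or of its inverse is divisibility between [a] and [b]. *)
  have [[u hu]|[u hu]] := tot _ (center_mul ca (center_inv cb)).
  - right; exists u; apply: iI; rewrite cb' iM -hu mulgVK //.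
  - left; exists u; apply: iI; rewrite ca' iM -hu invgF mulgVK //.
have cz : center G (i z).
  by case: hz => // ->; apply/fraction_center => a; apply/commute_sym/commute1.
exists (i z); apply/seteqP; split=> [g cg|g [n ->]]; last exact: center_expgz.
have [[a ea]|[a ea]] := tot g cg.
- have [|n an] := zgen a; first by rewrite -ea.
  by exists (Posz n); rewrite ea an fraction_exp.
- have [|n an] := zgen a; first by rewrite -ea; apply: center_inv.
  exists (- Posz n)%R.
  by rewrite expgzN /= -fraction_exp -an -ea invgK.
Qed.

Lemma trivial_group_of_garside1 : i D = 1 -> forall g, g = 1.
Proof.
move=> e g; have D1 : D = 1 by apply: iI; rewrite e i1.
have gD1 : garside_element_of_monoid (1 : M) by rewrite -D1.
have t := trivial_of_garside1 gM gD1.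
by have [a [b ->]] := iF g; rewrite (t a) (t b) mulgV.
Qed.

Lemma garside_exp_neq1 n : 0 < n -> i D ^+ n = 1 -> i D = 1.
Proof.
move=> n0 e; rewrite -i1; congr i; apply: (garside_exp_eq1 gM n0).
by apply: iI; rewrite fraction_exp e i1.
Qed.

End GarsideGroup.

(** * Comparing Garside elements through a cyclic center *)

Lemma periodic_of_cyclic_center (G : groupType) (D1 D2 g : G) :
  cyclic_subset (center G) -> garside_element D1 -> garside_element D2 ->
  periodic D1 g -> periodic D2 g.
Proof.
move=> [z hz] [M1 [i1 [E1 [gs1 e1]]]] [M2 [i2 [E2 [gs2 e2]]]] [k [l [k0 ekl]]].
have [m1 m10 c1] := garside_power_center gs1.
have [m2 m20 c2] := garside_power_center gs2.
rewrite e1 e2 hz in c1 c2; case: c1 c2 => a ha [b hb].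
have [D1n|D1n] := pselect (D1 = 1).
  exists (Posz 1), (Posz 0); split=> //=; rewrite -e1 in D1n.
  exact: trivial_group_of_garside1 gs1 D1n _.
have [D2n|D2n] := pselect (D2 = 1).
  exists (Posz 1), (Posz 0); split=> //=; rewrite -e2 in D2n.
  exact: trivial_group_of_garside1 gs2 D2n _.
(* Otherwise a positive power of [D2] is 1, which forces [D2 = 1]. *)
have b0 : b <> Posz 0.
  move=> b0; apply: D2n; rewrite -e2.
  by apply: (garside_exp_neq1 gs2 m20); rewrite e2 hb b0.
(* With [D1 ^ m1 = z ^ a] and [D2 ^ m2 = z ^ b], both sides equal [z ^ (l * a * b)]. *)
exists (k * (Posz m1 * b))%R, (Posz m2 * (l * a))%R; split.
  by move/eqP; rewrite !GRing.mulf_eq0 => /or3P[/eqP|/eqP|/eqP] //; lia.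
have {}ha : expgz D1 (Posz m1) = expgz z a := ha.
have {}hb : expgz D2 (Posz m2) = expgz z b := hb.
rewrite (expgzM g) ekl -expgzM GRing.mulrCA (expgzM _ (Posz m1)) ha (expgzM _ (Posz m2)) hb.
by rewrite -!expgzM GRing.mulrCA (GRing.mulrC a) !GRing.mulrA (GRing.mulrC l).
Qed.

Theorem corollary3p2 (G : groupType) (hG : garside_group G) :
  (forall D1 D2 : G, garside_element D1 -> garside_element D2 ->
     forall g : G, periodic D1 g <-> periodic D2 g)
  <-> cyclic_subset (center G).
Proof.
split=> [hper|cZ D1 D2 h1 h2 g].
  have [M [i [D gs]]] := hG.
  apply: (cyclic_center_of_periodic gs) => D' gD' h.
  by apply: (hper D' (i D) gD' _ h).1; exists M, i, D.
by split; apply: periodic_of_cyclic_center.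
Qed.
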